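(* Let $k\ge3$, $n\ge0$ an integer, and $H$ a connected $k$-graph. Let $e',e''$ be edges of $H$, each containing at least three vertices of degree greater than $1$, and let $w_0\in e'$, $w_n\in e''$ with $d_H(w_0)=d_H(w_n)=2$. Suppose $H$ contains an internal loose path of length $n$ between $w_0$ and $w_n$. Let $H'$ be the $k$-graph obtained from $H$ by splitting $w_0$. If $\alpha(H)<\alpha^*$, then $\rho(H')<\rho(H)$.
   Context: A $k$-graph is a simple $k$-uniform hypergraph; $d_H(v)$ is the number of edges containing $v$. $\rho(H)$ is the spectral radius of the adjacency tensor of $H$ (order $k$, entries $1/(k-1)!$ at index tuples forming an edge, $0$ otherwise; maximal modulus of eigenvalues $\lambda$ with $\mathcal{A}x=\lambda x^{[k-1]}$, $x\ne0$), and $\alpha(H)=\rho(H)^{-k}$. An internal loose path of length $n\ge1$ between $w_0$ and $w_n$ consists of distinct edges $e_1,\dots,e_n$ of $H$ different from $e',e''$ and distinct vertices $w_0,\dots,w_n$ with $w_{i-1},w_i\in e_i$, $e_i\cap e_{i+1}=\{w_i\}$, $e_i\cap e_j=\emptyset$ for $|i-j|\ge2$, $d_H(w_i)=2$ for $1\le i\le n-1$, and every other vertex of each $e_i$ has degree $1$ in $H$; for $n=0$ it means $w_0=w_n$ (so $w_0\in e'\cap e''$). Splitting a degree-2 vertex $w$ with $E_H(w)=\{a,b\}$: delete $w$, add new vertices $u_1,\dots,u_k$, replace $a$ by $(a\setminus\{w\})\cup\{u_1\}$ and $b$ by $(b\setminus\{w\})\cup\{u_k\}$, and add the edge $\{u_1,\dots,u_k\}$.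 $\alpha^*=\frac13\big(4-c^{1/3}-c^{-1/3}\big)\approx0.24512$ with $c=(3\sqrt{69}+25)/2$; it is the unique root in $(0,1)$ of $(1-x)^5=x$.
   Formalization: For n = 0 the edges e' and e'' are required to be distinct (the two edges at w_0); if e' = e'' were allowed with n = 0 the claim fails, e.g. for a 3-edge with three long pendant loose paths. *)

(* Defs.v *)
From HB Require Import structures.
From mathcomp Require Import classical_sets reals exp.
(* Required last, so that set0, [set _ | _], etc. are those of finset. *)
From mathcomp Require Import all_boot all_order all_algebra complex.

Set Implicit Arguments.
Unset Strict Implicit.
Unset Printing Implicit Defensive.

Import Order.TTheory GRing.Theory Num.Theory.

(* The vertex set of a hypergraph is the whole finite type V; a hypergraph is
   identified with its set of edges. *)
Definition hypergraph (V : finType) := {set {set V}}.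

Section Hypergraph.
Variable V : finType.
Implicit Types (H : hypergraph V) (u v : V) (e : {set V}).

Definition k_graph (k : nat) H : Prop := forall e, e \in H -> #|e| = k.

Definition edges_at H v : {set {set V}} := [set e in H | v \in e].

Definition degree H v : nat := #|edges_at H v|.

Definition adjacent H : rel V :=
  fun u v => [exists e in H, (u \in e) && (v \in e)].

Definition connected_hypergraph H : Prop := forall u v, connect (adjacent H) u v.

(* Only w 0, ..., w n and e 1, ..., e n are meaningful.  For n = 0 the last
   field makes e' and e'' the two distinct edges at the vertex w 0. *)
Record is_internal_loose_path H (e' e'' : {set V}) (n : nat)
    (w : nat -> V) (e : nat -> {set V}) : Prop := IsInternalLoosePath {
  ilp_edge : forall i, 1 <= i <= n -> [/\ e i \in H, e i != e' & e i != e''];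
  ilp_edge_inj : {in [pred i | 1 <= i <= n] &, injective e};
  ilp_vertex_inj : {in [pred i | i <= n] &, injective w};
  ilp_incident : forall i, 1 <= i <= n -> w i.-1 \in e i /\ w i \in e i;
  ilp_consecutive : forall i, 1 <= i < n -> e i :&: e i.+1 = [set w i];
  ilp_disjoint : forall i j, 1 <= i -> i.+2 <= j -> j <= n ->
    e i :&: e j = set0;
  ilp_degree2 : forall i, 1 <= i < n -> degree H (w i) = 2;
  ilp_degree1 : forall i v, 1 <= i <= n -> v \in e i ->
    v != w i.-1 -> v != w i -> degree H v = 1;
  ilp_distinct : n = 0 -> e' != e''
}.

Definition internal_loose_path H (e' e'' : {set V}) (n : nat) (w0 wn : V) :
    Prop :=
  exists (w : nat -> V) (e : nat -> {set V}),
    [/\ w 0 = w0, w n = wn & is_internal_loose_path H e' e'' n w e].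

End Hypergraph.

Section Splitting.
Variables (V : finType) (k : nat) (w : V).

(* V without w, together with k new vertices u_1, ..., u_k; the vertex u_j is
   inr i with i = j - 1. *)
Definition split_vertex : finType := ({v : V | v != w} + 'I_k)%type.

(* The set (e \ {w}) together with the u_(i+1) such that P i. *)
Definition split_edge (e : {set V}) (P : pred nat) : {set split_vertex} :=
  [set x : split_vertex |
    match x with inl v => val v \in e | inr i => P (val i) end].

(* Meant for edges_at H w = [set a; b] with a != b. *)
Definition split_hypergraph (H : hypergraph V) (a b : {set V}) :
    hypergraph split_vertex :=
  [set split_edge e pred0 | e in H :\: [set a; b]]
  :|: [set split_edge a (pred1 0);
           split_edge b (pred1 k.-1);
           split_edge set0 predT].

Lemma card_split_edge (e : {set V}) (P : pred nat) :
  #|split_edge e P| = #|e :\ w| + count P (iota 0 k).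
Proof.
have -> : split_edge e P =
    (inl @: [set v : {v : V | v != w} | val v \in e])
    :|: (inr @: [set i : 'I_k | P i]).
  apply/setP=> -[v|i]; rewrite !inE.
    rewrite (mem_imset _ _ inl_inj) inE.
    by case: imsetP => [[? _ //]|_]; rewrite orbF.
  rewrite (mem_imset _ _ inr_inj) inE.
  by case: imsetP => [[? _ //]|_].
rewrite cardsU disjoint_setI0 ?cards0 ?subn0; last first.
  rewrite disjoint_subset; apply/subsetP=> x /imsetP[v _ ->].
  by rewrite inE; apply/imsetP=> -[].
rewrite (card_imset _ inl_inj) (card_imset _ inr_inj); congr (_ + _).
  rewrite -(card_imset _ val_inj); apply: eq_card => v; rewrite !inE.
  apply/imsetP/andP=> [[x + ->]|[vw ve]].
    by rewrite inE => xe; split; first exact: (valP x).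
  by exists (exist _ v vw); rewrite ?inE.
rewrite -sum1_card -sum1_count -[k in iota 0 k]subn0 big_mkord.
by apply: eq_bigl => i; rewrite inE.
Qed.

Lemma split_k_graph (H : hypergraph V) (a b : {set V}) :
  0 < k -> k_graph k H -> edges_at H w = [set a; b] ->
  k_graph k (split_hypergraph H a b).
Proof.
move=> k0 Hk Hw.
have cntP j : j < k -> count (pred1 j) (iota 0 k) = 1.
  by move=> jk; rewrite count_uniq_mem ?iota_uniq // mem_iota jk.
have inab e : e \in [set a; b] -> #|e :\ w|.+1 = k.
  by rewrite -Hw inE => /andP[eH we]; rewrite -(Hk _ eH) [RHS](cardsD1 w) we.
move=> e; rewrite !inE -!orbA => /or4P[/imsetP[f + ->]|||].
- rewrite inE -Hw inE => /andP[+ fH]; rewrite fH /= => wf.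
  rewrite card_split_edge count_pred0 addn0 -(Hk _ fH).
  by rewrite [RHS](cardsD1 w) (negbTE wf).
- by move=> /eqP->; rewrite card_split_edge cntP // addn1 inab // !inE eqxx.
- move=> /eqP->; rewrite card_split_edge cntP ?ltn_predL //.
  by rewrite addn1 inab // !inE eqxx orbT.
- by move=> /eqP->; rewrite card_split_edge set0D cards0 count_predT size_iota.
Qed.

End Splitting.

Section Spectrum.
Local Open Scope ring_scope.
Variables (R : realType) (V : finType) (k : nat).

(* The coordinate of A x at v is the sum, over the index tuples
   t = (v, i_2, ..., i_k), of A t * x_(i_2) * ... * x_(i_k). *)
Definition tensor_apply (A : k.-tuple V -> R[i]) (x : {ffun V -> R[i]}) (v : V)
    : R[i] :=
  \sum_(t : k.-tuple V | ohead t == Some v) A t * \prod_(u <- behead t) x u.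

Definition tensor_eigenvalue (A : k.-tuple V -> R[i]) (l : R[i]) : Prop :=
  exists2 x : {ffun V -> R[i]}, x != 0 &
    forall v, tensor_apply A x v = l * x v ^+ k.-1.

(* If 2 <= k and V is nonempty, a tensor has at least one and at most finitely
   many eigenvalues, so this sup is the maximal modulus. *)
Definition tensor_spectral_radius (A : k.-tuple V -> R[i]) : R :=
  sup [set ComplexField.Normc.normc l | l in tensor_eigenvalue A]%classic.

Definition adjacency_tensor (H : hypergraph V) (t : k.-tuple V) : R[i] :=
  if [set v in t] \in H then (k.-1)`!%:R^-1 else 0.

Definition rho (H : hypergraph V) : R :=
  tensor_spectral_radius (adjacency_tensor H).

Definition alpha (H : hypergraph V) : R := rho H ^- k.

End Spectrum.

Section AlphaStar.
Local Open Scope ring_scope.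
Variable R : realType.

Definition alpha_star : R :=
  let c := (3 * Num.sqrt 69 + 25) / 2 in
  (4 - c `^ 3^-1 - c `^ (- 3^-1)) / 3.

End AlphaStar.

(* Main.v *)
Require Import Defs.
From mathcomp Require Import classical_sets boolp functions reals exp.
From mathcomp Require Import topology normedtype derive.
From mathcomp Require Import all_boot all_order all_algebra complex ring lra.

(* The Perron vector x of H gives positive labels
   B(v,e) = prod_(u in e) x_u / (rho x_v^k): they sum to 1 over the edges at a vertex,
   and have product alpha over the vertices of an edge.  Conversely, labels on H' whose
   sum at each vertex is at most 1 and whose product over each edge is at least alpha
   bound rho(H') by rho(H), by the AM-GM inequality on each edge, and strictly so if
   some product exceeds alpha.  When w0 is split, labels t and alpha/t on the new edge,
   with t = B(w0,b), turn the label t in b into 1 - alpha/t, which is larger than t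
   exactly when alpha < B(w0,a) B(w0,b), that is, when B(w0,e') lies between the roots
   p < 1 - p of X^2 - X + alpha.

   A label at a vertex of degree > 1 is at most 1 - alpha, so three such vertices in e'
   give B(w0,e') >= alpha/(1-alpha)^2, and this exceeds p precisely because
   alpha < alpha_star.  The same bound for B(wn,e''), carried back along the path,
   gives B(w0,e') < 1 - p. *)

Set Implicit Arguments.
Unset Strict Implicit.
Unset Printing Implicit Defensive.

Import Order.TTheory GRing.Theory Num.Theory.
Import numFieldNormedType.Exports.

Local Open Scope ring_scope.

(** * Maximizing the edge polynomial over nonnegative vectors *)

Section MaximizingVector.
Local Open Scope classical_set_scope.
Variables (R : realType) (V : finType).

(** Up to the factor k this is the homogeneous form of the adjacency tensor. For connected H with an
    edge, its maximum over nonnegative vectors whose k-th powers sum to 1 turns out to be rho /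
    k. *)
Definition edge_form (H : hypergraph V) (x : V -> R) : R :=
  \sum_(e in H) \prod_(u in e) x u.

Lemma continuous_exp (T : topologicalType) (f : T -> R) (n : nat) :
  continuous f -> continuous (fun x => f x ^+ n).
Proof.
move=> cf; elim: n => [|n IHn] x; first exact: cvg_cst.
have -> : (fun y => f y ^+ n.+1) = (fun y => f y * f y ^+ n).
  by apply/funext => y; rewrite exprS.
by apply: (@continuousM _ T); [exact: cf|exact: IHn].
Qed.

Lemma continuous_sum (T : topologicalType) (I : Type) (r : seq I)
    (P : pred I) (f : I -> T -> R) :
  (forall i, P i -> continuous (f i)) ->
  continuous (fun x => \sum_(i <- r | P i) f i x).
Proof. exact: (@continuous_big R I +%R 0 P (@add_continuous R) T r f). Qed.

Lemma continuous_prod (T : topologicalType) (I : Type) (r : seq I)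
    (P : pred I) (f : I -> T -> R) :
  (forall i, P i -> continuous (f i)) ->
  continuous (fun x => \prod_(i <- r | P i) f i x).
Proof. exact: (@continuous_big R I *%R 1 P (@mul_continuous R) T r f). Qed.

Lemma continuous_edge_form (H : hypergraph V) :
  continuous (fun x : prod_topology (fun _ : V => R) => edge_form H x).
Proof.
apply: continuous_sum => e _; apply: continuous_prod => u _.
exact: (@proj_continuous V (fun _ => R) u).
Qed.

Lemma edge_form_scale (k : nat) (H : hypergraph V) (c : R) (x : V -> R) :
  k_graph k H -> edge_form H (fun v => c * x v) = c ^+ k * edge_form H x.
Proof.
move=> Hk; rewrite mulr_sumr; apply: eq_bigr => e eH.
by rewrite big_split /= prodr_const Hk.
Qed.

Lemma exists_root (k : nat) (s : R) : (0 < k)%N -> 0 < s ->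
  exists2 c, 0 < c & c ^+ k = s.
Proof.
move=> k0 s0; exists (s `^ k%:R^-1); first exact: powR_gt0.
rewrite -powR_mulrn ?powR_ge0 // -powRrM mulVf ?powRr1 ?ltW //.
by rewrite pnatr_eq0 -lt0n.
Qed.

(** The part of the unit sphere of the k-norm inside the cube [0,1]^V is compact by Tychonoff, and
    homogeneity of degree k turns the maximum on it into a bound for all nonnegative vectors. *)
Lemma exists_maximizer (k : nat) (H : hypergraph V) :
  (0 < k)%N -> k_graph k H -> H != finset.set0 ->
  exists (x : V -> R) (M : R),
    [/\ 0 < M, forall v, 0 <= x v, exists v, 0 < x v,
        edge_form H x = M * \sum_v x v ^+ k
      & forall y : V -> R, (forall v, 0 <= y v) ->
          edge_form H y <= M * \sum_v y v ^+ k].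
Proof.
move=> k0 Hk /set0Pn[e0 e0H].
have [v0 v0e0] : exists v, v \in e0.
  by apply/set0Pn; rewrite -card_gt0 (Hk _ e0H).
pose T := prod_topology (fun _ : V => R).
pose N (x : V -> R) := \sum_v x v ^+ k.
pose A : set T := [set x : T | forall v, `[0, 1] (x v)] `&` [set x : T | N x = 1].
have NE (c : R) x : N (fun v => c * x v) = c ^+ k * N x.
  by rewrite /N mulr_sumr; apply: eq_bigr => v _; rewrite exprMn.
have Npos x v : (forall v, 0 <= x v) -> 0 < x v -> 0 < N x.
  move=> x0 xv; rewrite /N (bigD1 v) //= ltr_wpDr ?exprn_gt0 //.
  by rewrite sumr_ge0 // => u _; rewrite exprn_ge0.
have normalize x : (forall v, 0 <= x v) -> (exists v, 0 < x v) ->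
    exists2 c, 0 < c & A (fun v => c * x v).
  move=> x0 [v xv]; have Nx := Npos _ _ x0 xv.
  have [|c c0 ck] := @exists_root k (N x)^-1 k0; first by rewrite invr_gt0.
  exists c => //; have N1 : N (fun v => c * x v) = 1.
    by rewrite NE ck mulVf // gt_eqF.
  split=> //= u; rewrite in_itv /= mulr_ge0 ?(ltW c0) //=.
  rewrite -(@expr_le1 _ k) ?mulr_ge0 ?(ltW c0) // -N1 /N (bigD1 u) //=.
  by rewrite lerDl sumr_ge0 // => w _; rewrite exprn_ge0 // mulr_ge0 // ltW.
have cA : compact A.
  apply: compact_closedI; last first.
    apply: (@preimage_closed _ _ (N : T -> R) [set 1]); last exact: closed_eq.
    move=> + _; apply: continuous_sum => v _.
    exact/continuous_exp/(@proj_continuous V (fun _ => R)).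
  by apply: (@tychonoff _ (fun _ : V => R) (fun _ => `[0, 1])) => v;
    exact: segment_compact.
have A0 : A !=set0.
  have ex1 : exists v : V, 0 < (1 : R) by exists v0.
  have [c _ Ac] := normalize (fun _ => 1) (fun _ => ler01) ex1.
  by eexists; exact: Ac.
have [|x + xmax] := @compact_EVT_max T R (edge_form H) A A0 cA.
  exact/continuous_subspaceT/continuous_edge_form.
move=> /set_mem[/= x01 Nx].
have x0 v : 0 <= x v by have := x01 v; rewrite /= in_itv /= => /andP[].
have bound y : (forall v, 0 <= y v) -> edge_form H y <= edge_form H x * N y.
  move=> y0; have [/existsP[v yv]|/existsPn y_le0] := boolP [exists v, 0 < y v].
    have [|c c0 /mem_set Ac] := normalize y y0; first by exists v.
    have cN : c ^+ k * N y = 1 by have [_ /= <-] := set_mem Ac; rewrite NE.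
    have := xmax _ Ac; rewrite (edge_form_scale _ _ Hk) => le_x.
    by rewrite -(ler_pM2l (exprn_gt0 k c0)) mulrCA cN mulr1.
  (* The zero vector cannot be normalized; here both sides vanish because k > 0. *)
  have y00 v : y v = 0 by apply/eqP; rewrite eq_le y0 leNgt y_le0.
  rewrite /N big1 ?mulr0; last by move=> v _; rewrite y00 expr0n gtn_eqF.
  rewrite /edge_form big1 // => e eH; rewrite (eq_bigr (fun _ => 0)) //.
  by rewrite prodr_const Hk // expr0n gtn_eqF.
(* The all-ones vector serves as a test: the edge [e0] alone contributes 1 to its form. *)
have M0 : 0 < edge_form H x.
  have := bound (fun _ => 1) (fun _ => ler01).
  have N1 : 0 < N (fun _ => 1) := Npos _ v0 (fun _ => ler01) ltr01.
  rewrite -(pmulr_lgt0 _ N1); apply: lt_le_trans.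
  rewrite /edge_form (bigD1 e0) //= big1 // ltr_pwDl // sumr_ge0 // => e _.
  by rewrite prodr_ge0.
exists x, (edge_form H x); rewrite -/(N x) Nx mulr1; split=> //.
apply/existsP; apply: contraT => /existsPn x_le0.
move/eqP: Nx; rewrite /N big1 1?eq_sym ?oner_eq0 // => v _.
have -> : x v = 0 by apply/eqP; rewrite eq_le x0 leNgt x_le0.
by rewrite expr0n gtn_eqF.
Qed.

End MaximizingVector.

(** * Positivity and eigenvalue equations of a maximizer *)

Section PerronVector.
Variables (R : realType) (V : finType) (k : nat) (H : hypergraph V).
Hypotheses (k1 : (1 < k)%N) (Hk : k_graph k H).
Variables (x : V -> R) (M : R).
Hypotheses (M0 : 0 < M) (x0 : forall v, 0 <= x v)
  (xM : edge_form H x = M * \sum_v x v ^+ k)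
  (Mmax : forall y : V -> R, (forall v, 0 <= y v) ->
     edge_form H y <= M * \sum_v y v ^+ k).

(* Otherwise some edge e contains both zeros and nonzeros of x.  Raising the m < k
   zeros of e to a small d increases the left side of Mmax by at least a multiple of
   d^m, but the right side only by M m d^k. *)
Lemma maximizer_gt0 : connected_hypergraph H -> (exists v, 0 < x v) ->
  forall v, 0 < x v.
Proof.
move=> Hconn [v1 xv1] v.
suff clo : fingraph.closed (adjacent H) [pred u | 0 < x u].
  by have := closed_connect clo (Hconn v1 v); rewrite !inE xv1.
apply: intro_closed => [u w|u w].
  by apply: sym_connect_sym => z t; apply: eq_existsb_in => f _; exact: andbC.
case/exists_inP=> e eH /andP[ue we]; rewrite !inE => xu; apply: contraT => xw.
pose Z := [set z in e | x z == 0]; pose m := #|Z|.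
have wZ : w \in Z by rewrite inE we eq_le x0 leNgt xw.
have uZ : u \notin Z by rewrite inE (gt_eqF xu) andbF.
have ZE : Z \subset e by apply/subsetP=> z; rewrite inE => /andP[].
have m0 : (0 < m)%N by rewrite card_gt0; apply/set0Pn; exists w.
have mk : (m < k)%N.
  rewrite -(Hk eH); apply: proper_card; rewrite properE ZE /=.
  by apply/subsetPn; exists u.
pose C := \prod_(z in e :\: Z) x z.
have C0 : 0 < C.
  apply: prodr_gt0 => z; rewrite !inE => /andP[+ ze]; rewrite ze /= => xz.
  by rewrite lt_def xz x0.
pose y d z : R := if z \in Z then d else x z.
have edge_ge d : 0 <= d -> edge_form H x + C * d ^+ m <= edge_form H (y d).
  move=> d0; have xy z : x z <= y d z.
    by rewrite /y; case: ifP => //; rewrite inE => /andP[_ /eqP->].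
  have xe : \prod_(z in e) x z = 0.
    by apply/eqP/prodf_eq0; exists w => //; move: wZ; rewrite inE => /andP[].
  have ye : \prod_(z in e) y d z = C * d ^+ m.
    rewrite (big_setID Z) /= (setIidPr ZE) mulrC; congr (_ * _).
      by apply: eq_bigr => z; rewrite !inE /y inE => /andP[/negbTE->].
    rewrite (eq_bigr (fun _ => d)) ?prodr_const // => z zZ.
    by rewrite /y zZ.
  rewrite /edge_form (bigD1 e) //= xe add0r [leRHS](bigD1 e) //= ye.
  rewrite [leLHS]addrC lerD2l; apply: ler_sum => f _; apply: ler_prod => z _.
  by rewrite x0 xy.
have sumE d : \sum_z y d z ^+ k = \sum_z x z ^+ k + m%:R * d ^+ k.
  rewrite (bigID [in Z]) [in RHS](bigID [in Z]) /= addrAC; congr (_ + _); last first.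
    by apply: eq_bigr => z /negbTE zZ; rewrite /y zZ.
  rewrite [in RHS]big1 ?add0r; last first.
    by move=> z; rewrite inE => /andP[_ /eqP->]; rewrite expr0n gtn_eqF // ltnW.
  rewrite (eq_bigr (fun _ => d ^+ k)) ?sumr_const ?mulr_natl // => z zZ.
  by rewrite /y zZ.
have small d : 0 < d -> d <= 1 -> C <= M * m%:R * d.
  move=> d0 d1.
  have y0 z : 0 <= y d z by rewrite /y; case: ifP => // _; exact: ltW.
  have := le_trans (edge_ge d (ltW d0)) (Mmax y0).
  rewrite sumE xM mulrDr lerD2l => CM.
  rewrite -(ler_pM2r (exprn_gt0 m d0)); apply: le_trans CM _.
  rewrite -!mulrA -exprS ler_wpM2l ?(ltW M0) // ler_wpM2l //.
  by rewrite ler_wiXn2l // ltW.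
(* This choice makes M m d at most C / 2, against [small]; the minimum with 1 is what [small]
   requires in order to bound d^k by d^(m+1). *)
pose d := Order.min 1 (C / (2 * (M * m%:R))).
have Mm : 0 < M * m%:R by rewrite mulr_gt0 ?ltr0n.
have d0 : 0 < d by rewrite lt_min ltr01 divr_gt0 // (mulr_gt0 _ Mm).
have d1 : d <= 1 by rewrite ge_min lexx.
have : C <= C / 2.
  apply: le_trans (small _ d0 d1) _; rewrite mulrC -ler_pdivlMr //.
  by rewrite ge_min -[X in X || _]/(_) -mulrA -invfM lexx orbT.
by lra.
Qed.

(** With all coordinates except the one at v fixed, M times the power sum minus the edge form is a
    function of one variable, nonnegative for t >= 0 and zero at x_v. Its derivative vanishes there,
    and multiplying by x_v completes the edge products. *)
Lemma maximizer_eigen (xgt0 : forall v, 0 < x v) (v : V) :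
  \sum_(e in H | v \in e) \prod_(u in e) x u = k%:R * M * x v ^+ k.
Proof.
set a := \sum_(e in H | v \in e) \prod_(u in e :\ v) x u.
set c := \sum_(e in H | v \notin e) \prod_(u in e) x u.
set S := \sum_(u | u != v) x u ^+ k.
pose y t u : R := if u == v then t else x u.
have yE t : edge_form H (y t) = a * t + c.
  rewrite /edge_form (bigID (fun e : {set V} => v \in e)) /=; congr (_ + _).
    rewrite mulr_suml; apply: eq_bigr => e /andP[_ ve].
    rewrite (big_setD1 v) //= {1}/y eqxx mulrC; congr (_ * _).
    by apply: eq_bigr => u; rewrite !inE /y => /andP[/negbTE->].
  apply: eq_bigr => e /andP[_ ve]; apply: eq_bigr => u ue.
  by rewrite /y; case: eqP => // uv; rewrite -uv ue in ve.
have yS t : \sum_u y t u ^+ k = t ^+ k + S.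
  rewrite (bigD1 v) //= {1}/y eqxx; congr (_ + _).
  by apply: eq_bigr => u /negbTE uv; rewrite /y uv.
have yx : y (x v) =1 x by move=> u; rewrite /y; case: eqP => // ->.
pose g t := M * (t ^+ k + S) - (a * t + c).
have g0 t : 0 <= t -> 0 <= g t.
  move=> t0; rewrite /g subr_ge0 -yE -yS; apply: Mmax => u.
  by rewrite /y; case: ifP.
have gx : g (x v) = 0.
  apply/eqP; rewrite /g subr_eq0 -yE -yS; apply/eqP.
  rewrite (eq_bigr (fun u => x u ^+ k)) => [|u _]; last by rewrite yx.
  by rewrite -xM; apply: eq_bigr => e _; apply: eq_bigr => u _; rewrite yx.
have dg (t : R) : is_derive t (1 : R) g (M * (k%:R * t ^+ k.-1) - a).
  have -> : g = M \*: (id ^+ k + cst S) - (a \*: id + cst c).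
    by apply/funext => s; rewrite /g !fctE.
  apply: is_derive_eq; rewrite !addr0 !scaler1 /=.
  by rewrite /GRing.scale /=.
have : k%:R * M * x v ^+ k.-1 = a.
  have : is_derive (x v) (1 : R) g 0.
    (* The interval from 0 to 2 x_v contains x_v in its interior and stays in the range of [g0]. *)
    apply: (@derive1_at_min _ g 0 (x v + x v)) => [|t _||].
    - by rewrite addr_ge0.
    - by case: (dg t).
    - by rewrite in_itv /= xgt0 ltrDl xgt0.
    - by move=> t; rewrite in_itv /= gx => /andP[t0 _]; apply: g0; exact: ltW.
  move=> d0; have := @derive_val _ _ _ _ _ _ _ d0.
  rewrite (@derive_val _ _ _ _ _ _ _ (dg (x v))) => /eqP.
  by rewrite subr_eq0 => /eqP <-; rewrite -mulrA mulrCA.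
move=> aE; transitivity (a * x v).
  rewrite mulr_suml; apply: eq_bigr => e /andP[_ ve].
  by rewrite (big_setD1 v) //= mulrC.
by rewrite -aE -mulrA -exprSr prednK // ltnW.
Qed.
End PerronVector.

(** * The tensor spectral radius as k times the maximum *)

Section SpectralRadius.
Variables (R : realType) (V : finType) (H : hypergraph V).
Import ComplexField.Normc.

Lemma tuple_card_uniq (k : nat) (t : k.-tuple V) :
  #|[set u in t]| = k -> uniq t.
Proof. by rewrite cardsE => tk; apply/card_uniqP; rewrite tk size_tuple. Qed.

Lemma tuple_ohead (k : nat) (t : k.+1.-tuple V) (v : V) :
  ohead t == Some v -> tval t = v :: behead t.
Proof. by case: t => -[|u s] //= _ /eqP[->]. Qed.

Lemma mem_tuple_ohead (k : nat) (t : k.+1.-tuple V) (u v : V) :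
  ohead t == Some v -> (u \in t) = (u == v) || (u \in behead t).
Proof. by move=> /tuple_ohead tE; rewrite -[u \in t]/(u \in tval t) tE inE. Qed.

(** The tail of such a tuple is an ordering of e without v; the count cancels the factorial in the
    entries of the adjacency tensor. *)
Lemma card_tuple_set (k : nat) (e : {set V}) (v : V) : #|e| = k.+1 -> v \in e ->
  #|[set t : k.+1.-tuple V | (ohead t == Some v) && ([set u in t] == e)]| = k`!.
Proof.
move=> ek ve.
have ck : #|e :\ v| = k by move: ek; rewrite (cardsD1 v) ve => -[].
transitivity #|[set s : k.-tuple V | all [in e :\ v] s & uniq s]|; last first.
  by rewrite card_uniq_tuples ck ffactnn.
rewrite -[RHS](card_imset _ (f := fun s : k.-tuple V => [tuple of v :: s])).
  apply: eq_card => t; rewrite !inE; apply/andP/imsetP => [[tv /eqP te]|].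
    have tE := tuple_ohead tv.
    exists [tuple of behead t]; last exact: val_inj.
    have : uniq t by apply: tuple_card_uniq; rewrite te.
    rewrite inE {1}tE /= => /andP[vt ->]; rewrite andbT; apply/allP => u ut.
    rewrite !inE -te inE (mem_tuple_ohead _ tv) ut orbT andbT; apply: contraNneq vt => <- //.
  case=> s; rewrite inE => /andP[/allP se us] -> /=; split=> //.
  rewrite eqEcard; apply/andP; split.
    apply/subsetP=> u; rewrite !inE => /predU1P[->//|/se].
    by rewrite !inE => /andP[].
  rewrite ek cardsE /= (card_uniqP _) /= ?size_tuple // us andbT.
  by apply/negP => /se; rewrite !inE eqxx.
by move=> s t /(congr1 val)[] /val_inj.
Qed.

Lemma tensor_applyE (k : nat) (x : {ffun V -> R[i]}) (v : V) :
  (0 < k)%N -> k_graph k H ->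
  tensor_apply (@adjacency_tensor R V k H) x v =
    \sum_(e in H | v \in e) \prod_(u in e :\ v) x u.
Proof.
case: k => // k _ Hk.
rewrite /tensor_apply /adjacency_tensor.
(* Tuples whose support is not an edge contribute 0; the others are grouped by their support. *)
rewrite (bigID (fun t : k.+1.-tuple V => [set u in t] \in H)) /= addrC big1 ?add0r.
  rewrite (partition_big (fun t : k.+1.-tuple V => [set u in t])
     (fun e => (e \in H) && (v \in e))) /=; last first.
    by move=> t /andP[tv ->]; rewrite inE (mem_tuple_ohead _ tv) eqxx.
  apply: eq_bigr => e /andP[eH ve].
  rewrite (eq_bigr (fun _ => k`!%:R^-1 * \prod_(u in e :\ v) x u)).
    rewrite sumr_const -[RHS]mul1r -mulrnAl; congr (_ * _).
    rewrite (eq_card (B := mem [set t : k.+1.-tuple V |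
      (ohead t == Some v) && ([set u in t] == e)])).
      by rewrite card_tuple_set ?(Hk e) // -mulr_natr mulVf // pnatr_eq0 -lt0n fact_gt0.
    move=> t; rewrite !inE -topredE /= -andbA; congr (_ && _).
    by case: eqP => [->|]; rewrite ?andbF // eH.
  move=> t /andP[/andP[tv tH] /eqP te]; rewrite tH; congr (_ * _).
  have tE := tuple_ohead tv.
  have : uniq t by apply: tuple_card_uniq; rewrite te Hk.
  rewrite {1}tE /= => /andP[vt ut].
  rewrite big_uniq //=; apply: eq_bigl => u.
  rewrite !inE -te inE (mem_tuple_ohead _ tv); case: eqVneq => [->|] //=; exact: negbTE.
by move=> t /andP[_ /negbTE->]; rewrite mul0r.
Qed.

Lemma normc_sum (I : Type) (r : seq I) (P : pred I) (F : I -> R[i]) :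
  normc (\sum_(i <- r | P i) F i) <= \sum_(i <- r | P i) normc (F i).
Proof.
elim/big_rec2: _ => [|i y z _ le_zy]; first by rewrite normc0.
exact: le_trans (le_normcD _ _) (lerD _ _).
Qed.

Lemma normc_prod (I : Type) (r : seq I) (P : pred I) (F : I -> R[i]) :
  normc (\prod_(i <- r | P i) F i) = \prod_(i <- r | P i) normc (F i).
Proof. by elim/big_rec2: _ => [|i y z _ <-]; rewrite ?normc1 ?normcM. Qed.

Lemma normc_exp (y : R[i]) (n : nat) : normc (y ^+ n) = normc y ^+ n.
Proof. by elim: n => [|n IHn]; rewrite ?normc1 // !exprS normcM IHn. Qed.

Lemma sum_edges_at (k : nat) (x : V -> R) : k_graph k H ->
  \sum_v \sum_(e in H | v \in e) \prod_(u in e) x u = k%:R * edge_form H x.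
Proof.
move=> Hk; rewrite (exchange_big_dep [in H]) /=; last by move=> v e _ /andP[].
rewrite mulr_sumr; apply: eq_bigr => e eH.
rewrite (eq_bigl [in e]) => [|v]; last by rewrite eH.
by rewrite sumr_const (Hk e eH) mulr_natl.
Qed.

(** The vector x is itself an eigenvector, nonzero because [v0] exists, so k M is attained. For a
    complex eigenvector z with eigenvalue l, the triangle inequality bounds |l| times the k-th power
    sum of |z| by k times the edge form of |z|, to which [Mmax] applies. *)
Lemma rho_maximizer (v0 : V) (k : nat) (x : V -> R) (M : R) :
  (1 < k)%N -> k_graph k H -> 0 < M -> (forall v, 0 < x v) ->
  (forall v, \sum_(e in H | v \in e) \prod_(u in e) x u = k%:R * M * x v ^+ k) ->
  (forall y : V -> R, (forall v, 0 <= y v) ->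
     edge_form H y <= M * \sum_v y v ^+ k) ->
  rho R k H = k%:R * M.
Proof.
move=> k1 Hk M0 x0 xE Mmax; have k0 := ltnW k1.
have lam0 : 0 <= k%:R * M by rewrite mulr_ge0 // ltW.
pose E := [set normc l | l in tensor_eigenvalue (@adjacency_tensor R V k H)]%classic.
have Elam : E (k%:R * M).
  exists (k%:R * M)%:C%C; last by rewrite /normc /= expr0n addr0 sqrtr_sqr ger0_norm.
  exists [ffun v => (x v)%:C%C].
    apply/eqP => /ffunP/(_ v0); rewrite !ffunE => -[] /eqP.
    by rewrite gt_eqF.
  move=> v; rewrite tensor_applyE // ffunE -rmorphXn -rmorphM /=.
  under eq_bigr => e _ do (under eq_bigr => u _ do rewrite ffunE).
  under eq_bigr => e _ do rewrite -rmorph_prod.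
  rewrite -rmorph_sum /=; congr (_%:C)%C; apply: (mulfI (lt0r_neq0 (x0 v))).
  rewrite mulrCA -exprS prednK // -xE mulr_sumr; apply: eq_bigr => e /andP[_ ve].
  by rewrite [RHS](big_setD1 v).
have ubE : ubound E (k%:R * M).
  move=> _ [l [z z0 zE] <-]; pose X u := normc (z u).
  have X0 u : 0 <= X u by rewrite /X; case: (z u) => a b; exact: sqrtr_ge0.
  have NX : 0 < \sum_v X v ^+ k.
    rewrite lt_def sumr_ge0 ?andbT => [|u _]; last exact: exprn_ge0.
    apply: contraNneq z0 => /psumr_eq0P X00; apply/eqP/ffunP => v.
    rewrite ffunE; apply: eq0_normc.
    have /eqP := X00 (fun u _ => exprn_ge0 k (X0 u)) v isT.
    by rewrite expf_eq0 k0 => /eqP.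
  rewrite -(ler_pM2r NX) -mulrA; apply: le_trans (ler_wpM2l _ (Mmax _ X0)) => //.
  rewrite -sum_edges_at // mulr_sumr; apply: ler_sum => v _.
  have /(congr1 (fun y => normc y * X v)) := zE v.
  rewrite normcM normc_exp -mulrA -exprSr prednK // => <-; rewrite tensor_applyE //.
  apply: le_trans (ler_wpM2r (X0 v) (normc_sum _ _ _)) _.
  rewrite mulr_suml le_eqVlt; apply/orP; left; apply/eqP.
  by apply: eq_bigr => e /andP[_ ve]; rewrite normc_prod [RHS](big_setD1 v) //= mulrC.
apply/le_anti/andP; split; first by apply: ge_sup => //; exists (k%:R * M).
by apply: ub_le_sup => //; exists (k%:R * M).
Qed.

End SpectralRadius.

Lemma perron_vector (R : realType) (V : finType) (k : nat) (H : hypergraph V) :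
  (1 < k)%N -> k_graph k H -> connected_hypergraph H -> H != set0 ->
  exists x : V -> R,
    [/\ forall v, 0 < x v, 0 < rho R k H
      & forall v, \sum_(e in H | v \in e) \prod_(u in e) x u
          = rho R k H * x v ^+ k].
Proof.
move=> k1 Hk Hconn H0.
have [x [M [M0 x0 xpos xM Mmax]]] := exists_maximizer R (ltnW k1) Hk H0.
have xgt0 := maximizer_gt0 k1 Hk M0 x0 xM Mmax Hconn xpos.
have xE := maximizer_eigen k1 x0 xM Mmax xgt0.
have [v0 _] := xpos.
have rhoE := rho_maximizer v0 k1 Hk M0 xgt0 xE Mmax.
exists x; rewrite rhoE; split=> //.
by rewrite mulr_gt0 // ltr0n ltnW.
Qed.

(** * The AM-GM bound on a labelled edge *)

Section EdgeBound.
Variables (R : realType) (V : finType) (k : nat) (e : {set V}) (r : R).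
Variables (c x : V -> R).
Hypotheses (k0 : (0 < k)%N) (ek : #|e| = k) (r0 : 0 < r)
  (c0 : {in e, forall v, 0 <= c v}) (x0 : {in e, forall v, 0 < x v}).

(** AM-GM for the k numbers c_v x_v^k, with the denominator cleared and both sides kept as k-th
    powers so that no root appears. *)
Lemma edge_AGM : \prod_(v in e) c v * (k%:R * \prod_(v in e) x v) ^+ k
  <= (\sum_(v in e) c v * x v ^+ k) ^+ k.
Proof.
have E0 : {in e, forall v, 0 <= c v * x v ^+ k}.
  by move=> v ve; rewrite mulr_ge0 ?c0 // exprn_ge0 // ltW // x0.
have := leif_AGM E0; rewrite ek => -[+ _].
rewrite big_split /= prodrXl expr_div_n ler_pdivlMr ?exprn_gt0 ?ltr0n //.
by rewrite -mulrA -exprMn [_ * k%:R]mulrC.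
Qed.

(** Summed over the edges, these bounds have k times the edge form on the left, and on the right at
    most r times the k-th power sum as soon as the labels at each vertex sum to at most 1. *)
Lemma edge_bound : r ^- k <= \prod_(v in e) c v ->
  k%:R * \prod_(v in e) x v <= r * \sum_(v in e) c v * x v ^+ k.
Proof.
move=> rc.
have X0 : 0 <= k%:R * \prod_(v in e) x v.
  by rewrite mulr_ge0 // prodr_ge0 // => v /x0/ltW.
have S0 : 0 <= \sum_(v in e) c v * x v ^+ k.
  by rewrite sumr_ge0 // => v ve; rewrite mulr_ge0 ?c0 // exprn_ge0 // ltW // x0.
have rS : 0 <= r * \sum_(v in e) c v * x v ^+ k by rewrite mulr_ge0 // ltW.
rewrite -(@ler_pXn2r _ k) // [leRHS]exprMn -ler_pdivrMl ?exprn_gt0 //.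
apply: le_trans edge_AGM.
by rewrite ler_wpM2r // exprn_ge0.
Qed.

Lemma edge_bound_strict : r ^- k < \prod_(v in e) c v ->
  k%:R * \prod_(v in e) x v < r * \sum_(v in e) c v * x v ^+ k.
Proof.
move=> rc.
have X0 : 0 < k%:R * \prod_(v in e) x v.
  by rewrite mulr_gt0 ?ltr0n // prodr_gt0.
have S0 : 0 <= \sum_(v in e) c v * x v ^+ k.
  by rewrite sumr_ge0 // => v ve; rewrite mulr_ge0 ?c0 // exprn_ge0 // ltW // x0.
have rS : 0 <= r * \sum_(v in e) c v * x v ^+ k by rewrite mulr_ge0 // ltW.
rewrite -(@ltr_pXn2r _ k) ?nnegrE ?(ltW X0) // [ltRHS]exprMn.
rewrite -ltr_pdivrMl ?exprn_gt0 //; apply: lt_le_trans edge_AGM.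
by rewrite ltr_pM2r // exprn_gt0.
Qed.

End EdgeBound.

(** * The cubic behind [alpha_star] *)

Section AlphaStar.
Variable R : realType.

(** With t the cube root of c and s = t + 1/t, [alpha_star] is (4 - s)/3, and Cardano's identity s^3
    - 3s = c + 1/c = 25 yields the cubic. It is the cofactor of 1 - x + x^2 in (1 - x)^5 - x. *)
Lemma alpha_star_root :
  alpha_star R < 1 /\
  1 - 5 * alpha_star R + 4 * alpha_star R ^+ 2 - alpha_star R ^+ 3 = 0.
Proof.
rewrite /alpha_star; set c := (3 * Num.sqrt 69 + 25) / 2.
have s0 : 0 <= Num.sqrt 69 :> R by exact: sqrtr_ge0.
have s2 : Num.sqrt 69 ^+ 2 = 69 :> R by rewrite sqr_sqrtr.
have c0 : 0 < c by rewrite /c; lra.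
have cE : c ^+ 2 - 25 * c + 1 = 0 by rewrite /c; nra.
have t0 : 0 < c `^ 3^-1 by exact: powR_gt0.
have t3 : (c `^ 3^-1) ^+ 3 = c.
  by rewrite -powR_mulrn ?powR_ge0 // -powRrM mulVf ?pnatr_eq0 // powRr1 // ltW.
rewrite powRN; set t := c `^ 3^-1 in t0 t3 *.
have tn0 : t != 0 by rewrite gt_eqF.
set s := t + t^-1.
have -> : (4 - t - t^-1) / 3 = (4 - s) / 3 by rewrite /s; lra.
have s_ge2 : 2 <= s.
  suff : 0 <= (t - 1) ^+ 2 / t by rewrite (_ : _ / t = s - 2) ?subr_ge0 // /s; field.
  by rewrite divr_ge0 ?sqr_ge0 // ltW.
have s3 : s ^+ 3 - 3 * s = 25.
  have -> : s ^+ 3 - 3 * s = (t ^+ 3 ^+ 2 + 1) / t ^+ 3 by rewrite /s; field.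
  rewrite t3; apply: (mulIf (lt0r_neq0 c0)); rewrite divfK ?gt_eqF //.
  by lra.
by split; [lra | nra].
Qed.

(** Here p and 1 - p are the roots of X^2 - X + a, so the last claim says (1 - a)^2 < 1 - p, that is
    2(1 - a)^2 - 1 < d with d^2 = 1 - 4a. The difference 1 - 4a - (2(1 - a)^2 - 1)^2 is 4a times the
    cubic of [alpha_star_root] at a. *)
Lemma lt_alpha_star (a : R) : 0 < a -> a < alpha_star R ->
  exists p : R, [/\ 0 < p, p < 1, p * (1 - p) = a & p * (1 - a) ^+ 2 < a].
Proof.
move=> a0 aas; have [as1 asE] := alpha_star_root.
set s := alpha_star R in aas as1 asE.
(* In u = 1 - a the cubic is u^3 + u^2 - 1, increasing for u > 0, hence positive for a below its
   root. *)
have q0 : 0 < 1 - 5 * a + 4 * a ^+ 2 - a ^+ 3.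
  rewrite -asE -subr_gt0.
  have -> : 1 - 5 * a + 4 * a ^+ 2 - a ^+ 3 - (1 - 5 * s + 4 * s ^+ 2 - s ^+ 3)
    = (s - a) * ((1 - a) + (1 - s) + (1 - a) ^+ 2 + (1 - a) * (1 - s) + (1 - s) ^+ 2).
    by ring.
  have u0 : 0 < 1 - a by lra.
  have v0 : 0 < 1 - s by lra.
  apply: mulr_gt0; first by lra.
  by do ?[exact: u0 | exact: v0 | apply: addr_gt0 | apply: exprn_gt0 | apply: mulr_gt0].
(* The cubic is -1/64 at 1/4 and decreases from there to 1, so its positivity forces a < 1/4. *)
have a14 : a < 4^-1.
  rewrite ltNge; apply/negP => a4.
  have : 0 <= (a - 4^-1) * ((1 - a) + (1 - a) ^+ 2 + 3/4 * (1 - a)).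
    by rewrite mulr_ge0 //; nra.
  nra.
pose d := Num.sqrt (1 - 4 * a).
have d0 : 0 < d by rewrite sqrtr_gt0; lra.
have d2 : d ^+ 2 = 1 - 4 * a by rewrite sqr_sqrtr //; lra.
have d1 : d < 1 by nra.
have Dd : 2 * (1 - a) ^+ 2 - 1 < d.
  rewrite ltNge; apply/negP => dD.
  have : d ^+ 2 <= (2 * (1 - a) ^+ 2 - 1) ^+ 2 by rewrite ler_pXn2r // nnegrE; lra.
  have : 0 < a * (1 - 5 * a + 4 * a ^+ 2 - a ^+ 3) by rewrite mulr_gt0.
  nra.
have p0 : 0 < (1 - d) / 2 by lra.
exists ((1 - d) / 2); split=> //; [lra | nra | ].
have aE : a = (1 - d) / 2 * ((1 + d) / 2) by nra.
by rewrite [ltRHS]aE ltr_pM2l //; lra.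
Qed.

End AlphaStar.

(** * Bounds on the labels of an alpha-normal labelling *)

Section NormalLabelling.
Variables (R : realType) (V : finType) (H : hypergraph V) (a : R).
Variable B : V -> {set V} -> R.
Hypotheses (a0 : 0 < a) (B0 : forall v e, 0 < B v e)
  (Bsum : forall v, \sum_(e in H | v \in e) B v e = 1)
  (Bprod : forall e, e \in H -> \prod_(v in e) B v e = a).
Implicit Types (u v w : V) (e f : {set V}).

Lemma label_sum_degree2 v e f : degree H v = 2 -> e \in H -> f \in H ->
  v \in e -> v \in f -> e != f -> B v e + B v f = 1.
Proof.
move=> dv eH fH ve vf ef; rewrite -(Bsum v).
have EE : edges_at H v = [set e; f].
  apply/esym/eqP; rewrite eqEcard cards2 ef -/(degree H v) dv andbT.
  by apply/subsetP=> g /set2P[]->; rewrite inE ?eH ?fH.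
rewrite (eq_bigl (fun g => g \in [set e; f])) => [|g]; last by rewrite -EE inE.
by rewrite big_setU1 ?big_set1 // inE.
Qed.

Lemma label_degree1 v e : degree H v = 1%N -> e \in H -> v \in e -> B v e = 1.
Proof.
move=> dv eH ve; rewrite -(Bsum v).
have EE : edges_at H v = [set e].
  apply/esym/eqP; rewrite eqEcard cards1 -/(degree H v) dv andbT.
  by apply/subsetP=> g /set1P->; rewrite inE eH.
rewrite (eq_bigl (fun g => g \in [set e])) => [|g]; last by rewrite -EE inE.
by rewrite big_set1.
Qed.

Lemma label_le1 v e : e \in H -> v \in e -> B v e <= 1.
Proof.
move=> eH ve; rewrite -(Bsum v) (bigD1 e) ?eH //= lerDl sumr_ge0 // => f _.
exact: ltW.
Qed.

Lemma label_prod_le1 e (P : pred V) : e \in H ->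
  \prod_(v in e | P v) B v e <= 1.
Proof.
move=> eH; rewrite prodr_ile1 // => v /andP[ve _].
by rewrite ltW //= label_le1.
Qed.

Lemma label_ge v e : e \in H -> v \in e -> a <= B v e.
Proof.
move=> eH ve; rewrite -(Bprod eH) (bigD1 v) //= ler_piMr ?(ltW (B0 _ _)) //.
exact: label_prod_le1.
Qed.

(** A second edge at v carries a label at least a, and the labels at v sum to 1. *)
Lemma label_branching v e : (1 < degree H v)%N -> e \in H -> v \in e ->
  B v e <= 1 - a.
Proof.
move=> dv eH ve; have : (0 < #|edges_at H v :\ e|)%N.
  by move: dv; rewrite /degree (cardsD1 e) inE eH ve.
rewrite card_gt0 => /set0Pn[f]; rewrite !inE => /andP[fe /andP[fH vf]].
rewrite lerBrDr; apply: (@le_trans _ _ (B v e + B v f)).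
  by rewrite lerD2l label_ge.
rewrite -(Bsum v) (bigD1 e) ?eH //= lerD2l (bigD1 f) ?fH ?vf //= lerDl.
by rewrite sumr_ge0 // => g _; exact: ltW.
Qed.

(** In the product a over e, two branching vertices other than w contribute at most (1 - a)^2 and
    the remaining ones at most 1. *)
Lemma label_three_branching w e : e \in H -> w \in e ->
  (1 < degree H w)%N -> (3 <= #|[set v in e | 1 < degree H v]|)%N ->
  a <= B w e * (1 - a) ^+ 2.
Proof.
move=> eH we dw; rewrite (cardsD1 w) inE we dw ltnS => /card_gt1P[u [v []]].
rewrite !inE => /and3P[uw ue du] /and3P[vw ve dv] uv.
rewrite -[leLHS](Bprod eH) (bigD1 w) //= ler_wpM2l ?(ltW (B0 _ _)) //.
rewrite (bigD1 u) /= ?ue // (bigD1 v) /= ?ve ?vw 1?eq_sym //.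
have Bu := label_branching du eH ue; have Bv := label_branching dv eH ve.
have u0 := ltW (B0 u e); have v0 := ltW (B0 v e).
set r := (X in _ * (_ * X) <= _).
have r0 : 0 <= r by rewrite prodr_ge0 // => z _; exact: ltW.
have r1 : r <= 1.
  by rewrite /r; under eq_bigl => z do rewrite -!andbA; exact: label_prod_le1.
have vr : B v e * r <= 1 - a by apply: le_trans Bv; rewrite ler_piMr.
by rewrite expr2 ler_pM // mulr_ge0.
Qed.

(* Along the path the label r_i of w_i in the edge behind it satisfies
   r_(i+1) = a / (1 - r_i), an increasing map with fixed point 1 - p. *)
Lemma label_path_lt (e' e'' : {set V}) (n : nat) (w0 wn : V) (p : R) :
  0 < p -> p * (1 - p) = a -> e' \in H -> e'' \in H -> w0 \in e' -> wn \in e'' ->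
  degree H w0 = 2 -> degree H wn = 2 ->
  internal_loose_path H e' e'' n w0 wn -> p < B wn e'' -> B w0 e' < 1 - p.
Proof.
move=> p0 pa e'H e''H w0e' wne'' d0 dn [w [e [w0E wnE path]]] pB.
(* [E] lists e', e_1, ..., e_n, e'', so that [E i] and [E i.+1] are the two edges at w_i for 0 <= i
   <= n, also when n = 0. *)
pose E i := if i is 0%N then e' else if (i <= n)%N then e i else e''.
have EnS i : (0 < i <= n)%N -> E i = e i by case: i => //= i ->.
have EnL : E n.+1 = e'' by rewrite /= ltnn.
have EH i : E i \in H.
  case: i => // i /=; case: ifP => // ni.
  by have [] := ilp_edge path (i := i.+1) ni.
have wE i : (i <= n)%N -> w i \in E i.
  case: i => [_|i ni]; first by rewrite w0E.
  by rewrite EnS //; have [] := ilp_incident path (i := i.+1) ni.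
have wES i : (i <= n)%N -> w i \in E i.+1.
  rewrite leq_eqVlt => /predU1P[->|ni]; first by rewrite EnL wnE.
  by rewrite EnS //; have [] := ilp_incident path (i := i.+1) ni.
have dw i : (i <= n)%N -> degree H (w i) = 2.
  rewrite leq_eqVlt => /predU1P[->|ni]; first by rewrite wnE.
  case: i ni => [_|i ni]; first by rewrite w0E.
  exact: (ilp_degree2 path (i := i.+1)).
have EE i : (i <= n)%N -> E i != E i.+1.
  rewrite leq_eqVlt => /predU1P[->|ni].
    rewrite EnL; case: (posnP n) => [n0|n0].
      by rewrite n0 /=; exact: (ilp_distinct path).
    rewrite EnS ?n0 ?leqnn //.
    by have [] := ilp_edge path (i := n); rewrite ?n0 ?leqnn.
  rewrite [E i.+1]EnS //; case: i ni => [|i] ni.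
    by have [_ ? _] := ilp_edge path (i := 1%N) ni; rewrite /= eq_sym.
  rewrite EnS ?(ltnW ni) //; apply/eqP => /(ilp_edge_inj path).
  rewrite !inE ni (ltnW ni) => /(_ isT isT) /eqP.
  by rewrite -[X in X == _]addn0 -[X in _ == X]addn1 eqn_add2l.
have sumB i : (i <= n)%N -> B (w i) (E i) + B (w i) (E i.+1) = 1.
  by move=> ni; rewrite label_sum_degree2 ?dw ?EH ?wE ?wES ?EE.
(* All other vertices of this edge have degree 1, hence label 1. *)
have prodB i : (i < n)%N -> B (w i) (E i.+1) * B (w i.+1) (E i.+1) = a.
  move=> ni; have iN : (0 < i.+1 <= n)%N by [].
  have ww : w i.+1 != w i.
    apply/eqP => /(ilp_vertex_inj path); rewrite !inE ni (ltnW ni).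
    by move=> /(_ isT isT) /eqP; rewrite eqn_leq ltnn.
  have := wES i (ltnW ni); have := wE i.+1 ni; have := EH i.+1.
  rewrite (EnS _ iN) => eH w1e we.
  rewrite -[RHS](Bprod eH) (bigD1 (w i)) ?we //= (bigD1 (w i.+1)) ?w1e //=.
  rewrite big1 ?mulr1 // => v /andP[/andP[ve vi] vi1].
  exact: label_degree1 (ilp_degree1 path iN ve vi vi1) eH ve.
rewrite -w0E ltNge; apply/negP => p_le.
(* The assumed bound at w_0 propagates to w_n, where it forces the label in e'' to be at most p. *)
have {}p_le i : (i <= n)%N -> 1 - p <= B (w i) (E i).
  elim: i => [//|i IHi] ni; have := IHi (ltnW ni).
  have := sumB i (ltnW ni); have := prodB i ni.
  have := B0 (w i) (E i.+1); have := B0 (w i.+1) (E i.+1).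
  move: (B _ _) (B _ _) (B _ _) => r x y r0 x0 xr xy yp.
  have xp : x <= p by lra.
  by rewrite -(ler_pM2l p0) pa -xr ler_pM2r.
have := p_le n (leqnn n); have := sumB n (leqnn n).
rewrite EnL wnE; lra.
Qed.

Lemma label_split_vertex (e' e'' : {set V}) (n : nat) (w0 wn : V) :
  a < alpha_star R -> e' \in H -> e'' \in H -> w0 \in e' -> wn \in e'' ->
  (3 <= #|[set v in e' | 1 < degree H v]|)%N ->
  (3 <= #|[set v in e'' | 1 < degree H v]|)%N ->
  degree H w0 = 2 -> degree H wn = 2 ->
  internal_loose_path H e' e'' n w0 wn ->
  a < B w0 e' * (1 - B w0 e').
Proof.
move=> aas e'H e''H w0e' wne'' e'3 e''3 d0 dn path.
have [p [p0 p1 pa pa1]] := lt_alpha_star a0 aas.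
(* The inequality 0 < a <= B(w0,e') (1 - a)^2 rules out a = 1. *)
have a1 : 0 < (1 - a) ^+ 2.
  rewrite -(pmulr_rgt0 _ (B0 w0 e')); apply: lt_le_trans a0 _.
  by apply: label_three_branching; rewrite ?d0.
have gt_p e w : e \in H -> w \in e -> (3 <= #|[set v in e | 1 < degree H v]|)%N ->
    degree H w = 2 -> p < B w e.
  move=> eH we e3 dw; rewrite -(ltr_pM2r a1); apply: lt_le_trans pa1 _.
  by apply: label_three_branching; rewrite ?dw.
have pB' := gt_p _ _ e'H w0e' e'3 d0.
have B'p := label_path_lt p0 pa e'H e''H w0e' wne'' d0 dn path
  (gt_p _ _ e''H wne'' e''3 dn).
(* At X = B(w0,e') this product is X(1 - X) - p(1 - p), and p(1 - p) = a. *)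
have : 0 < (B w0 e' - p) * ((1 - p) - B w0 e') by rewrite mulr_gt0 ?subr_gt0.
by rewrite -pa; lra.
Qed.

End NormalLabelling.

(** * Labelling the split hypergraph *)

Section SplitBound.
Variables (V : finType) (k : nat) (w : V).
Implicit Types (H : hypergraph V) (e a b : {set V}).

Local Notation vertex' := (split_vertex k w).

Lemma big_split_edge (T : Type) (idx : T) (op : Monoid.com_law idx)
    (e : {set V}) (P : pred nat) (F : vertex' -> T) :
  \big[op/idx]_(z in split_edge k w e P) F z =
  op (\big[op/idx]_(v : {v | v != w} | val v \in e) F (inl v))
     (\big[op/idx]_(i < k | P i) F (inr i)).
Proof.
rewrite big_sumType; congr (op _ _); apply: eq_bigl => z; by rewrite inE.
Qed.

Lemma ler_sum_setU (R : numDomainType) (T : finType) (A B : {set T}) (F : T -> R) :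
  (forall z, 0 <= F z) ->
  \sum_(z in A :|: B) F z <= \sum_(z in A) F z + \sum_(z in B) F z.
Proof.
move=> F0; rewrite [leLHS]big_mkcond [X in _ <= X + _]big_mkcond.
rewrite [X in _ <= _ + X]big_mkcond -big_split; apply: ler_sum => z _.
by rewrite inE; do 2 case: (z \in _); rewrite /= ?addr0 ?add0r ?lerDl.
Qed.

Lemma split_edge_inj e1 e2 (P1 P2 : pred nat) : w \notin e1 -> w \notin e2 ->
  split_edge k w e1 P1 = split_edge k w e2 P2 -> e1 = e2.
Proof.
move=> we1 we2 /setP eq12; apply/setP=> v.
have [->|vw] := eqVneq v w; first by rewrite (negbTE we1) (negbTE we2).
by have := eq12 (inl (exist _ v vw)); rewrite !inE.
Qed.

Lemma edge_avoids H a b e : edges_at H w = [set a; b] ->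
  e \in H :\: [set a; b] -> e \in H /\ w \notin e.
Proof.
by move=> Hw; rewrite inE -Hw inE => /andP[+ eH]; rewrite eH.
Qed.

(** Coincidences among the listed edges could only lower the left side, as all products are
    nonnegative; an inequality thus replaces a proof that the edges are distinct. *)
Lemma edge_form_split_le (R : realType) H a b (x : vertex' -> R) :
  edges_at H w = [set a; b] -> (forall z, 0 < x z) ->
  edge_form (split_hypergraph k w H a b) x <=
    \sum_(e in H :\: [set a; b]) \prod_(z in split_edge k w e pred0) x z
    + (\prod_(z in split_edge k w a (pred1 0%N)) x z
       + \prod_(z in split_edge k w b (pred1 k.-1)) x z
       + \prod_(z in split_edge k w set0 predT) x z).
Proof.
move=> Hw x0; have P0 A : 0 <= \prod_(z in A : {set vertex'}) x z.
  by rewrite prodr_ge0 // => z _; exact: ltW.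
apply: le_trans (ler_sum_setU _ _ P0) _; apply: lerD.
  rewrite big_imset // => e1 e2 /(edge_avoids Hw)[_ we1] /(edge_avoids Hw)[_ we2].
  exact: split_edge_inj.
apply: le_trans (ler_sum_setU _ _ P0) _; rewrite big_set1 lerD2r.
by apply: le_trans (ler_sum_setU _ _ P0) _; rewrite !big_set1.
Qed.

(** Sending w to u_1 carries adjacent vertices of H to connected ones, since the edges replacing a
    and b meet the new edge in u_1 and u_k. Every vertex of the split hypergraph is connected to
    such an image. *)
Lemma connected_split H a b : (0 < k)%N -> edges_at H w = [set a; b] ->
  connected_hypergraph H -> connected_hypergraph (split_hypergraph k w H a b).
Proof.
move=> k0 Hw Hconn; set H' := split_hypergraph k w H a b.
have wa : w \in a by have := set21 a b; rewrite -Hw inE => /andP[].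
have wb : w \in b by have := set22 a b; rewrite -Hw inE => /andP[].
have symH' : connect_sym (adjacent H').
  by apply: sym_connect_sym => z t; apply: eq_existsb_in => f _; exact: andbC.
pose u1 : vertex' := inr (Ordinal k0).
have adjH' (A : {set vertex'}) z1 z2 : A \in H' -> z1 \in A -> z2 \in A ->
    connect (adjacent H') z1 z2.
  by move=> AH z1A z2A; apply: connect1; apply/exists_inP; exists A => //; rewrite z1A.
have fH : split_edge k w set0 predT \in H' by rewrite !inE eqxx !orbT.
have inr_conn i j : connect (adjacent H') (inr i) (inr j).
  by apply: (adjH' _ _ _ fH); rewrite inE.
have kk : (k.-1 < k)%N by rewrite ltn_predL.
pose phi v : vertex' := if insub v is Some s then inl s else u1.
have phiE (s : {v | v != w}) : phi (val s) = inl s by rewrite /phi valK.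
have phi_w : phi w = u1 by rewrite /phi insubF // eqxx.
have phi_edge e : e \in H -> exists2 A, A \in H' & forall v, v \in e ->
    exists2 z, z \in A & connect (adjacent H') (phi v) z.
  have phi_in P v : v \in e -> v != w -> phi v \in split_edge k w e P.
    by move=> ve vw; rewrite /phi insubT inE.
  move=> eH; have [we|we] := boolP (w \in e); last first.
    exists (split_edge k w e pred0).
      rewrite inE imset_f // inE eH andbT -Hw inE negb_and we orbT //.
    move=> v ve; exists (phi v) => //; apply: phi_in => //.
    by apply: contraNneq we => <-.
  have : e \in edges_at H w by rewrite inE eH.
  rewrite Hw => /set2P[] eE; subst e.
    exists (split_edge k w a (pred1 0%N)); first by rewrite !inE eqxx !orbT.
    move=> v va; have [->|vw] := eqVneq v w; last by exists (phi v); first exact: phi_in.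
    by exists u1; rewrite ?inE ?phi_w.
  exists (split_edge k w b (pred1 k.-1)); first by rewrite !inE eqxx !orbT.
  move=> v va; have [->|vw] := eqVneq v w; last by exists (phi v); first exact: phi_in.
  by exists (inr (Ordinal kk)); rewrite ?inE ?phi_w //=; exact: inr_conn.
have phi_conn u v : connect (adjacent H') (phi u) (phi v).
  have /connectP[p + ->] := Hconn u v.
  elim: p u => //= t p IHp u /andP[/exists_inP[e eH /andP[ue te]] /IHp].
  apply: connect_trans; have [A AH AP] := phi_edge e eH.
  have [z1 z1A uz1] := AP u ue; have [z2 z2A tz2] := AP t te.
  apply: connect_trans uz1 _; rewrite symH'; apply: connect_trans tz2 _.
  exact: adjH' AH z2A z1A.
have to_phi z : exists v, connect (adjacent H') z (phi v).
  case: z => [s|i]; first by exists (val s); rewrite phiE.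
  by exists w; rewrite phi_w; exact: inr_conn.
move=> z1 z2; have [v1 zv1] := to_phi z1; have [v2 zv2] := to_phi z2.
apply: connect_trans zv1 _; rewrite symH'; apply: connect_trans zv2 _.
exact: phi_conn.
Qed.

Lemma prod_edge_label (R : realType) (B : V -> {set V} -> R) (g : nat -> R) e
    (P : pred nat) :
  \prod_(z in split_edge k w e P)
    match z with inl v => B (val v) e | inr i => g i end =
  \prod_(v in e | v != w) B v e * \prod_(i < k | P i) g i.
Proof.
rewrite big_split_edge; congr (_ * _).
rewrite -(big_sub_cond [pred v | v != w] (mem e) (fun v => B v e)).
by apply: eq_bigl => v; exact: andbC.
Qed.

Section Weights.
Variables (R : realType) (H : hypergraph V) (a b : {set V}) (r : R).
Variables (B : V -> {set V} -> R) (x : vertex' -> R).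
Hypotheses (k1 : (1 < k)%N) (Hk : k_graph k H) (Hw : edges_at H w = [set a; b])
  (ab : a != b) (r0 : 0 < r) (x0 : forall z, 0 < x z)
  (B0 : forall v e, 0 < B v e)
  (Bsum : forall v, \sum_(e in H | v \in e) B v e = 1)
  (Bprod : forall e, e \in H -> \prod_(v in e) B v e = r ^- k)
  (Bw : B w a + B w b = 1) (Bab : r ^- k < B w a * B w b).

(* The new edge gets the labels B w b, r^-k / B w b and 1, ..., 1 at u_1, u_k and the
   other new vertices; the old label B w b becomes 1 - r^-k / B w b, which is larger. *)
Lemma edge_form_split_lt :
  k%:R * edge_form (split_hypergraph k w H a b) x < r * \sum_z x z ^+ k.
Proof.
have k0 := ltnW k1; have H'k := split_k_graph k0 Hk Hw.
have al0 : 0 < r ^- k by rewrite invr_gt0 exprn_gt0.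
have Bw1 := Bw; have Bab1 := Bab; have Bprod1 := Bprod.
set al := r ^- k in Bprod1 Bab1 al0; set t := B w b in Bw1 Bab1.
set y := B w a in Bw1 Bab1.
have y0 : 0 < y by exact: B0. have t0 : 0 < t by exact: B0.
have aH : a \in H by have := set21 a b; rewrite -Hw inE => /andP[].
have bH : b \in H by have := set22 a b; rewrite -Hw inE => /andP[].
have wa : w \in a by have := set21 a b; rewrite -Hw inE => /andP[].
have wb : w \in b by have := set22 a b; rewrite -Hw inE => /andP[].
pose s := 1 - al / t.
(* By [Bab], al / t < y = 1 - t. *)
have ts : t < s by rewrite /s ltrBrDl -ltrBrDr ltr_pdivrMr // -[1]Bw1 addrK.
have s0 : 0 < s := lt_trans t0 ts.
have at0 : 0 < al / t by rewrite divr_gt0.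
pose S e := \sum_(v : {v | v != w} | val v \in e) B (val v) e * x (inl v) ^+ k.
(* Index 0 is u_1 and index [k.-1] is u_k; they differ because k > 1. *)
pose g_f i := if i == 0%N then t else if i == k.-1 then al / t else 1.
pose c e (g : nat -> R) (z : vertex') :=
  match z with inl v => B (val v) e | inr i => g i end.
have c0 e g z : (forall i, 0 < g i) -> 0 <= c e g z.
  by move=> g0; apply: ltW; case: z => u; [exact: B0 | exact: g0].
have sumE e g P : \sum_(z in split_edge k w e P) c e g z * x z ^+ k =
    S e + \sum_(i < k | P i) g i * x (inr i) ^+ k by rewrite big_split_edge.
have H'E : split_hypergraph k w H a b =
  [set split_edge k w e pred0 | e in H :\: [set a; b]]
  :|: [set split_edge k w a (pred1 0%N); split_edge k w b (pred1 k.-1);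
           split_edge k w set0 predT] by [].
have old_le e : e \in H :\: [set a; b] ->
    k%:R * \prod_(z in split_edge k w e pred0) x z <= r * S e.
  move=> eab; have [eH we] := edge_avoids Hw eab.
  have := @edge_bound R _ k (split_edge k w e pred0) r (c e (fun=> 1)) x k0.
  rewrite sumE [X in S e + X]big_pred0_eq addr0; apply=> //.
  - by apply: H'k; rewrite H'E inE imset_f.
  - by move=> z _; apply: c0.
  - rewrite prod_edge_label [X in _ * X]big_pred0_eq mulr1 -/al -(Bprod1 _ eH).
    rewrite le_eqVlt; apply/orP; left; apply/eqP/eq_bigl => v.
    by case: eqVneq => [->|]; rewrite ?(negbTE we) ?andbT.
have ordk : (k.-1 < k)%N by rewrite ltn_predL.
have prod_w e : e \in H -> w \in e -> \prod_(v in e | v != w) B v e = al / B w e.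
  move=> eH we; have Bn0 := lt0r_neq0 (B0 w e); apply: (mulfI Bn0).
  by rewrite [RHS]mulrCA divff // mulr1 -(Bprod1 _ eH) [RHS](bigD1 w).
have first_le : k%:R * \prod_(z in split_edge k w a (pred1 0%N)) x z
    <= r * (S a + y * x (inr (Ordinal k0)) ^+ k).
  have := @edge_bound R _ k (split_edge k w a (pred1 0%N)) r (c a (fun=> y)) x k0.
  rewrite sumE (big_pred1 (Ordinal k0)) //; apply=> //.
  - by apply: H'k; rewrite H'E !inE eqxx ?orbT.
  - by move=> z _; apply: c0.
  - by rewrite prod_edge_label prod_w // (big_pred1 (Ordinal k0)) // divfK ?gt_eqF.
(* The labels in this edge multiply to (al / t) s > al, since s > t; this edge is the source of
   strictness. *)
have last_lt : k%:R * \prod_(z in split_edge k w b (pred1 k.-1)) x z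
    < r * (S b + s * x (inr (Ordinal ordk)) ^+ k).
  have := @edge_bound_strict R _ k (split_edge k w b (pred1 k.-1)) r (c b (fun=> s)) x k0.
  rewrite sumE (big_pred1 (Ordinal ordk)) //; apply=> //.
  - by apply: H'k; rewrite H'E !inE eqxx ?orbT.
  - by move=> z _; apply: c0.
  - rewrite prod_edge_label prod_w // (big_pred1 (Ordinal ordk)) //.
    by rewrite -mulrA [_ * s]mulrC ltr_pMr // ltr_pdivlMr ?mul1r.
have k10 : (k.-1 == 0%N) = false by rewrite -subn1 subn_eq0 leqNgt k1.
have new_le : k%:R * \prod_(z in split_edge k w set0 predT) x z
    <= r * \sum_(i < k) g_f i * x (inr i) ^+ k.
  have := @edge_bound R _ k (split_edge k w set0 predT) r (c set0 g_f) x k0.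
  have S0 : S set0 = 0 by rewrite /S big_pred0 // => v; rewrite inE.
  rewrite sumE S0 add0r.
  apply=> //.
  - by apply: H'k; rewrite H'E !inE eqxx ?orbT.
  - by move=> z _; apply: c0 => i; rewrite /g_f; do 2?case: ifP.
  - rewrite prod_edge_label big_pred0 => [|v]; last by rewrite inE.
    rewrite mul1r (bigD1 (Ordinal k0)) //= (bigD1 (Ordinal ordk)) /=; last first.
      by rewrite -val_eqE /= k10.
    rewrite big1 ?mulr1 => [|i]; last first.
      by rewrite -!val_eqE /g_f /= => /andP[/negbTE-> /negbTE->].
    by rewrite /g_f /= k10 eqxx mulrC divfK ?gt_eqF.
apply: (@lt_le_trans _ _ (r * (\sum_(e in H :\: [set a; b]) S e
    + (S a + y * x (inr (Ordinal k0)) ^+ k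
       + (S b + s * x (inr (Ordinal ordk)) ^+ k)
       + \sum_(i < k) g_f i * x (inr i) ^+ k)))).
  apply: le_lt_trans (ler_wpM2l _ (edge_form_split_le Hw x0)) _ => //.
  rewrite !mulrDr; apply: ler_ltD.
    by rewrite !mulr_sumr; apply: ler_sum => e; exact: old_le.
  apply: ltr_leD; last exact: new_le.
  rewrite -!mulrDr in first_le last_lt *.
  by rewrite [ltLHS]mulrDr [ltRHS]mulrDr; exact: ler_ltD.
rewrite ler_wpM2l ?(ltW r0) //.
(* Each old vertex keeps its labels from H, which sum to 1. *)
have SE : \sum_(e in H) S e = \sum_(v : {v | v != w}) x (inl v) ^+ k.
  rewrite /S (exchange_big_dep predT) //=; apply: eq_bigr => v _.
  by rewrite -mulr_suml Bsum mul1r.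
have SabE : \sum_(e in H :\: [set a; b]) S e + (S a + S b) = \sum_(e in H) S e.
  have abH : [set a; b] \subset H.
    by apply/subsetP=> e; rewrite -Hw inE => /andP[].
  rewrite [RHS](big_setID [set a; b]) /= (setIidPr abH) addrC; congr (_ + _).
  by rewrite big_setU1 ?big_set1 // inE.
(* The labels sum to y + t = 1 at u_1 and to s + al / t = 1 at u_k; every other new vertex has the
   single label 1. *)
have gE : y * x (inr (Ordinal k0)) ^+ k + s * x (inr (Ordinal ordk)) ^+ k
    + \sum_(i < k) g_f i * x (inr i) ^+ k = \sum_(i < k) x (inr i) ^+ k.
  have k1k0 : Ordinal ordk != Ordinal k0 by rewrite -val_eqE /= k10.
  rewrite (bigD1 (Ordinal k0)) //= (bigD1 (Ordinal ordk)) //=.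
  rewrite [RHS](bigD1 (Ordinal k0)) //= [in RHS](bigD1 (Ordinal ordk)) //=.
  rewrite {1 2}/g_f /= k10 eqxx.
  rewrite (eq_bigr (fun i => x (inr i) ^+ k)) => [|i]; last first.
    by rewrite -!val_eqE /g_f /= => /andP[/negbTE-> /negbTE->]; rewrite mul1r.
  by rewrite (_ : y = 1 - t) /s; [ring | lra].
rewrite [leRHS]big_sumType /= -SE -SabE -gE le_eqVlt; apply/orP; left; apply/eqP.
by ring.
Qed.

End Weights.
End SplitBound.

(** * Comparison of the two spectral radii *)

Lemma split_rho_lt (R : realType) (V : finType) (k : nat) (H : hypergraph V)
    (w : V) (a b : {set V}) (B : V -> {set V} -> R) :
  (1 < k)%N -> k_graph k H -> connected_hypergraph H ->
  edges_at H w = [set a; b] -> a != b -> 0 < rho R k H ->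
  (forall v e, 0 < B v e) ->
  (forall v, \sum_(e in H | v \in e) B v e = 1) ->
  (forall e, e \in H -> \prod_(v in e) B v e = alpha R k H) ->
  B w a + B w b = 1 -> alpha R k H < B w a * B w b ->
  rho R k (split_hypergraph k w H a b) < rho R k H.
Proof.
move=> k1 Hk Hconn Hw ab rho0 B0 Bsum Bprod Bw Bab.
have k0 := ltnW k1; have H'k := split_k_graph k0 Hk Hw.
have H'0 : split_hypergraph k w H a b != set0.
  by apply/set0Pn; exists (split_edge k w set0 predT); rewrite !inE eqxx !orbT.
have [x [x0 _ xE]] := perron_vector R k1 H'k (connected_split k0 Hw Hconn) H'0.
have N0 : 0 < \sum_z x z ^+ k.
  rewrite (bigD1 (inr (Ordinal k0))) //= ltr_wpDr ?exprn_gt0 //.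
  by rewrite sumr_ge0 // => z _; rewrite exprn_ge0 // ltW.
(* For the Perron vector x of the split hypergraph, its spectral radius times the power sum is k
   times the edge form, to which the strict bound applies. *)
rewrite -(ltr_pM2r N0); apply: le_lt_trans
  (edge_form_split_lt k1 Hk Hw ab rho0 x0 B0 Bsum Bprod Bw Bab).
by rewrite -(sum_edges_at _ H'k) mulr_sumr ler_sum // => z _; rewrite xE.
Qed.

Local Close Scope ring_scope.

Theorem theorem4p1 (R : realType) (V : finType) (k n : nat)
    (H : hypergraph V) (e' e'' : {set V}) (w0 wn : V) (a b : {set V})
    (hk : 3 <= k)
    (Hgraph : k_graph k H)
    (Hconn : connected_hypergraph H)
    (He' : e' \in H)
    (He'' : e'' \in H)
    (He'3 : 3 <= #|[set v in e' | 1 < degree H v]|)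
    (He''3 : 3 <= #|[set v in e'' | 1 < degree H v]|)
    (Hw0 : w0 \in e')
    (Hwn : wn \in e'')
    (Hdw0 : degree H w0 = 2)
    (Hdwn : degree H wn = 2)
    (Hpath : internal_loose_path H e' e'' n w0 wn)
    (Hab : a != b)
    (HEw0 : edges_at H w0 = [set a; b])
    (Halpha : (alpha R k H < alpha_star R)%R) :
  (rho R k (split_hypergraph k w0 H a b) < rho R k H)%R.
Proof.
have k1 : 1 < k := ltnW hk.
have H0 : H != set0 by apply/set0Pn; exists e'.
have [x [x0 rho0 xE]] := perron_vector R k1 Hgraph Hconn H0.
pose B v (e : {set V}) : R := (\prod_(u in e) x u / (rho R k H * x v ^+ k))%R.
have d0 v : (0 < rho R k H * x v ^+ k)%R by rewrite mulr_gt0 ?exprn_gt0.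
have B0 v e : (0 < B v e)%R by rewrite divr_gt0 ?prodr_gt0.
have Bsum v : (\sum_(e in H | v \in e) B v e = 1)%R.
  by rewrite -mulr_suml xE divff // gt_eqF.
(* The numerators give the k-th power of the edge product, the denominators rho^k times the same
   power. *)
have Bprod e : e \in H -> (\prod_(v in e) B v e = alpha R k H)%R.
  move=> eH; rewrite big_split /= prodr_const prodfV big_split /= prodrXl.
  rewrite prodr_const (Hgraph _ eH) invfM mulrCA divff ?mulr1 //.
  by rewrite gt_eqF // exprn_gt0 // prodr_gt0.
have al0 : (0 < alpha R k H)%R by rewrite invr_gt0 exprn_gt0.
have [aH wa] : a \in H /\ w0 \in a.
  by apply/andP; have := set21 a b; rewrite -HEw0 inE.
have [bH wb] : b \in H /\ w0 \in b.
  by apply/andP; have := set22 a b; rewrite -HEw0 inE.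
have Bw := label_sum_degree2 Bsum Hdw0 aH bH wa wb Hab.
have Bab : (alpha R k H < B w0 a * B w0 b)%R.
  have := label_split_vertex al0 B0 Bsum Bprod Halpha He' He'' Hw0 Hwn He'3
    He''3 Hdw0 Hdwn Hpath.
  (* The edge e' is a or b, and 1 - B(w0,e') is the label of the other one by [Bw]. *)
  have : e' \in [set a; b] by rewrite -HEw0 inE He'.
  rewrite -Bw => /set2P[] ->; first by rewrite [(_ - _)%R]addrC addKr.
  by rewrite addrK mulrC.
exact: split_rho_lt Bab.
Qed.
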